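(* Let $Z$ be a $d$-dimensional lattice zonotope in $\mathbb{R}^d$ and let $p$ be a positive integer. If $\delta(H_1(d,p))\leq\delta(Z)$, then $k(H_1(d,p))\leq k(Z)$. If moreover $\delta(H_1(d,p))<\delta(Z)$, then $k(H_1(d,p))<k(Z)$. If $\delta(H_1(d,p))=\delta(Z)$ and $k(H_1(d,p))=k(Z)$, then $Z$ is a translate of $H_1(d,p)$.
   Context: A lattice polytope in $\mathbb{R}^d$ is a polytope with all vertices in $\mathbb{Z}^d$. A zonotope is a Minkowski sum of finitely many pairwise non-collinear line segments; a lattice zonotope is a zonotope that is a lattice polytope. A point of $\mathbb{Z}^d$ is primitive if it is nonzero and the gcd of its coordinates is $1$. For a positive integer $p$, $H_1(d,p)$ is the zonotope $\sum_x[0,x]$, where $x$ ranges over all primitive points of $\mathbb{Z}^d$ with $\|x\|_1\leq p$ whose first nonzero coordinate is positive. For a polytope $P$, $\delta(P)$ is the diameter of its graph (vertices and edges). For a $d$-dimensional lattice polytope $P$, $k(P)$ is the smallest integer $k$ such that some translate of $P$ by a vector of $\mathbb{Z}^d$ is contained in $[0,k]^d$. *)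

(* Defs.v *)
From HB Require Import structures.
From mathcomp Require Import all_boot all_order all_algebra.
From mathcomp Require Import boolp classical_sets functions cardinality fsbigop.
From mathcomp Require Import reals.

Set Implicit Arguments.
Unset Strict Implicit.
Unset Printing Implicit Defensive.

Import Order.TTheory GRing.Theory Num.Theory.

Local Open Scope classical_set_scope.
Local Open Scope ring_scope.

Section Polytopes.
Context {R : realType} {d : nat}.
Implicit Types (A P F Z : set 'rV[R]_d) (a b u v : 'rV[R]_d).

Definition dot u v : R := \sum_(i < d) u ord0 i * v ord0 i.

Definition affine_hull A : set 'rV[R]_d :=
  [set y | exists n (w : 'I_n -> R) (x : 'I_n -> 'rV[R]_d),
     [/\ forall i, A (x i), \sum_i w i = 1 & y = \sum_i w i *: x i]].

Definition convex_hull A : set 'rV[R]_d :=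
  [set y | exists n (w : 'I_n -> R) (x : 'I_n -> 'rV[R]_d),
     [/\ forall i, A (x i), forall i, 0 <= w i,
         \sum_i w i = 1 & y = \sum_i w i *: x i]].

Definition has_dim A (k : nat) : Prop :=
  exists (x0 : 'rV[R]_d) (U : {vspace 'rV[R]_d}),
    \dim U = k /\ affine_hull A = [set x0 + u | u in [set u | u \in U]].

Definition segment a b : set 'rV[R]_d :=
  [set (1 - t) *: a + t *: b | t in [set t : R | 0 <= t <= 1]].

Definition translate u A : set 'rV[R]_d := [set u + x | x in A].

(* Meaningful when [D] is finite, or more generally when every selection [f]
   vanishes at all but finitely many indices of [D]. *)
Definition minkowski_sum (I : choiceType) (D : set I) (S : I -> set 'rV[R]_d) :
    set 'rV[R]_d :=
  [set y | exists2 f : I -> 'rV[R]_d,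
     (forall i, D i -> S i (f i)) & y = \sum_(i \in D) f i].

Definition polytope P : Prop :=
  exists2 V : set 'rV[R]_d, finite_set V & P = convex_hull V.

(* [c = 0] gives the improper faces [P] and [set0]. *)
Definition face P F : Prop :=
  exists (c : 'rV[R]_d) (b : R),
    (forall x, P x -> dot c x <= b) /\ F = P `&` [set x | dot c x = b].

Definition vertex P v : Prop := face P [set v].

Definition edge P F : Prop := face P F /\ has_dim F 1.

Definition adjacent P u v : Prop :=
  [/\ vertex P u, vertex P v & edge P (segment u v)].

Definition walk P u v (n : nat) : Prop :=
  exists s : seq 'rV[R]_d,
    [/\ path (fun x y => `[< adjacent P x y >]) u s, last u s = v & size s = n].

Definition graph_dist P u v (n : nat) : Prop :=
  walk P u v n /\ forall m, walk P u v m -> (n <= m)%N.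

Definition is_diameter P (n : nat) : Prop :=
  (forall u v, vertex P u -> vertex P v ->
     exists2 m, graph_dist P u v m & (m <= n)%N) /\
  (exists u v, [/\ vertex P u, vertex P v & graph_dist P u v n]).

(* [is_diameter P] is satisfied by at most one integer, and by one whenever [P]
   is a nonempty polytope; 0 is a junk value for other sets. *)
Definition diameter P : nat := xget 0%N (is_diameter P).

Definition lattice_point (z : 'rV[int]_d) : 'rV[R]_d := map_mx intr z.

Definition lattice_polytope P : Prop :=
  polytope P /\ forall v, vertex P v -> exists z, v = lattice_point z.

(* Segments are non-collinear when their directions are linearly independent:
   parallel segments on distinct lines count as collinear. *)
Definition zonotope Z : Prop :=
  exists (n : nat) (a b : 'I_n -> 'rV[R]_d),
    [/\ forall i, a i != b i,
        forall i j, i != j -> free [:: b i - a i; b j - a j] &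
        Z = minkowski_sum [set: 'I_n] (fun i => segment (a i) (b i))].

Definition lattice_zonotope Z : Prop := zonotope Z /\ lattice_polytope Z.

Definition fits_in_box P (k : int) : Prop :=
  exists z : 'rV[int]_d, forall x, translate (lattice_point z) P x ->
    forall i, 0 <= x ord0 i <= k%:~R.

Definition is_box_size P (k : int) : Prop :=
  fits_in_box P k /\ forall l, fits_in_box P l -> k <= l.

(* k(P); 0 is a junk value for sets without a least such integer, which for
   [0 < d] are the empty set and the unbounded sets. *)
Definition box_size P : int := xget 0 (is_box_size P).

Definition primitive (z : 'rV[int]_d) : Prop :=
  z != 0 /\ \big[gcdn/0%N]_(i < d) `|z ord0 i|%N = 1%N.

Definition norm1 (z : 'rV[int]_d) : int := \sum_(i < d) `|z ord0 i|.

Definition first_nonzero_pos (z : 'rV[int]_d) : Prop :=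
  exists i : 'I_d,
    0 < z ord0 i /\ forall j : 'I_d, (j < i)%N -> z ord0 j = 0.

Definition H1_generators (p : nat) : set 'rV[int]_d :=
  [set z | [/\ primitive z, norm1 z <= p%:Z & first_nonzero_pos z]].

End Polytopes.

Definition H1 (R : realType) (d p : nat) : set 'rV[R]_d :=
  minkowski_sum (H1_generators p) (fun z => segment 0 (lattice_point z)).

Arguments H1 R d p : clear implicits.

(* Main.v *)
(** The vertices of a zonotope correspond to the chambers of the arrangement of
   hyperplanes orthogonal to its generators: a generic functional is maximal at
   the corner spanned by the generators on which it is positive.  Crossing a
   wall of the arrangement follows an edge and flips one generator, and opposite
   chambers differ on every generator, so the diameter is the number of
   generators.

   In a lattice zonotope the generators are edge vectors, hence integral, and
   the box size [k] is the largest coordinate width; so [d * k] is at least the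
   sum of the 1-norms of the generators, with equality for [H1], whose
   coordinate widths agree by symmetry.  Replacing each generator by the
   primitive vector on its line does not increase its 1-norm and gives distinct
   primitive vectors up to sign.  Since [H1] is generated by those of 1-norm at
   most [p], it uniquely minimises the sum of the 1-norms among families with at
   least as many members. *)

Require Import Defs.
From HB Require Import structures.
From mathcomp Require Import all_boot all_order all_algebra finmap perm.
From mathcomp Require Import boolp classical_sets functions cardinality fsbigop.
From mathcomp Require Import reals.
From mathcomp Require Import ring lra.

Set Implicit Arguments.
Unset Strict Implicit.
Unset Printing Implicit Defensive.

Import Order.TTheory GRing.Theory Num.Theory.

Local Open Scope classical_set_scope.
Local Open Scope ring_scope.

Section Signs.
Context {R : realFieldType}.
Implicit Types x y : R.

Lemma sgr_addl_small x y : `|y| < `|x| -> Num.sg (x + y) = Num.sg x.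
Proof.
case: (ltrgt0P x) => [x0|x0|_]; last by rewrite ltNge normr_ge0.
- by rewrite ltr_norml => /andP[yl _]; rewrite !gtr0_sg //; lra.
- by rewrite ltr_norml => /andP[_ yr]; rewrite !ltr0_sg //; lra.
Qed.

Lemma eq_sgr_gt0 x y : Num.sg x = Num.sg y -> (0 < x) = (0 < y).
Proof. by move=> xy; rewrite -sgr_cp0 xy sgr_cp0. Qed.

Lemma eq_sgr_eq0 x y : Num.sg x = Num.sg y -> (x == 0) = (y == 0).
Proof. by move=> xy; rewrite -sgr_eq0 xy sgr_eq0. Qed.

Lemma eq_sgr_mul_gt0 x y : 0 < x * y -> Num.sg y = Num.sg x.
Proof.
case: (ltrgt0P x) => [x0|x0|->]; last by rewrite mul0r ltxx.
- by rewrite pmulr_rgt0 // => y0; rewrite !gtr0_sg.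
- by rewrite nmulr_rgt0 // => y0; rewrite !ltr0_sg.
Qed.

Lemma first_sign_change (I : finType) (a b : I -> R) (i0 : I) :
    (forall i, a i != 0) ->
    (forall i j, i != j -> a i * b j != a j * b i) -> a i0 * b i0 < 0 ->
  exists i r, [/\ a i * b i < 0, a i + r * b i = 0 &
    forall j, j != i -> Num.sg (a j + r * b j) = Num.sg (a j)].
Proof.
move=> a_neq0 cross i0D; pose r i := - a i / b i.
case: (@arg_minP _ _ _ i0 (fun i => a i * b i < 0) r i0D) => i iD r_min.
have b_neq0 j : a j * b j < 0 -> b j != 0.
  by apply: contraTneq => ->; rewrite mulr0 ltxx.
have r_root j : a j * b j < 0 -> a j + r j * b j = 0.
  by move=> /b_neq0 bj; rewrite divfK // subrr.
have r_gt0 : 0 < r i.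
  have -> : r i = - (a i * b i) / b i ^+ 2 by rewrite /r; field; exact: b_neq0.
  by rewrite divr_gt0 ?oppr_gt0 // exprn_even_gt0 ?b_neq0.
exists i, (r i); split=> // [|j ji]; first exact: r_root.
apply: eq_sgr_mul_gt0.
have [jD|jND] := ltP (a j * b j) 0; last first.
  rewrite mulrDr mulrCA -expr2 ltr_wpDr ?(mulr_ge0 (ltW r_gt0)) //.
  by rewrite exprn_even_gt0 ?a_neq0.
have lt_r : r i < r j.
  rewrite lt_neqAle r_min // andbT; apply: contraNneq (cross j i ji) => eq_r.
  have ai : a i = - (r i * b i) by apply/eqP; rewrite -addr_eq0 r_root.
  have aj : a j = - (r i * b j) by apply/eqP; rewrite eq_r -addr_eq0 r_root.
  by rewrite ai aj; apply/eqP; ring.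
have -> : a j + r i * b j = (r i - r j) * b j.
  by rewrite -[LHS]subr0 -(r_root _ jD); ring.
by rewrite mulrCA nmulr_rgt0 ?subr_lt0.
Qed.

End Signs.

Section Dot.
Context {R : realType} {d : nat}.
Implicit Types (c e u v w : 'rV[R]_d).

Lemma dotC u v : dot u v = dot v u.
Proof. by apply: eq_bigr => i _; rewrite mulrC. Qed.

Fact dot_linear u : scalar (dot u).
Proof.
move=> k v w; rewrite /dot mulr_sumr -big_split; apply: eq_bigr => i _.
by rewrite !mxE mulrDr mulrCA.
Qed.

Fact dot_bilinear : bilinear_for *%R *%R (@dot R d).
Proof. by split=> w k u v; rewrite ?(dotC _ w); exact: dot_linear. Qed.

HB.instance Definition _ := bilinear_isBilinear.Build R
  'rV[R]_d 'rV[R]_d R *%R *%R (@dot R d) dot_bilinear.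

Lemma dot_gt0 u : u != 0 -> 0 < dot u u.
Proof.
move=> /rV0Pn[i ui]; rewrite /dot (bigD1 i) //= ltr_pwDl //.
  by rewrite -expr2 exprn_even_gt0.
by apply: sumr_ge0 => j _; rewrite -expr2 sqr_ge0.
Qed.

Lemma sgr_dot_perturb (ws : seq 'rV[R]_d) c e :
  exists2 k : R, 0 < k & forall w, w \in ws -> dot c w != 0 ->
    Num.sg (dot (c + k *: e) w) = Num.sg (dot c w).
Proof.
pose bound w := `|dot c w| / (`|dot e w| + 1).
have den_gt0 w : 0 < `|dot e w| + 1 by rewrite ltr_wpDl.
exists (\big[Num.min/1]_(w <- ws | dot c w != 0) bound w).
  by apply: lt_bigmin => // w cw; rewrite divr_gt0 ?normr_gt0.
set k := (X in X *: e) => w w_ws cw; rewrite linearDl linearZl_LR /=.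
apply: sgr_addl_small.
have k_gt0 : 0 < k by apply: lt_bigmin => // v cv; rewrite divr_gt0 ?normr_gt0.
have : k <= bound w by exact: ge_bigmin_seq.
rewrite ler_pdivlMr //; apply: lt_le_trans.
by rewrite normrM gtr0_norm // ltr_pM2l // ltrDl.
Qed.

Lemma exists_generic (ws : seq 'rV[R]_d) :
  exists e, forall w, w \in ws -> w != 0 -> dot e w != 0.
Proof.
elim: ws => [|w ws [e e_gen]]; first by exists 0.
have [k k_gt0 sgk] := sgr_dot_perturb (w :: ws) e w.
exists (e + k *: w) => v v_ws v_neq0.
have [ev|ev] := eqVneq (dot e v) 0; last by rewrite (eq_sgr_eq0 (sgk v _ _)).
move: v_ws; rewrite inE => /predU1P[vw|v_ws].
  rewrite vw in ev v_neq0 *; rewrite linearDl linearZl_LR /= ev add0r.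
  by rewrite mulf_neq0 ?gt_eqF ?dot_gt0.
by have := e_gen v v_ws v_neq0; rewrite ev eqxx.
Qed.

Lemma exists_generic_near (ws : seq 'rV[R]_d) c :
  exists c', forall w, w \in ws ->
    (w != 0 -> dot c' w != 0) /\
    (dot c w != 0 -> Num.sg (dot c' w) = Num.sg (dot c w)).
Proof.
have [e e_gen] := exists_generic ws.
have [k k_gt0 sgk] := sgr_dot_perturb ws c e.
exists (c + k *: e) => w w_ws; split=> [w_neq0|]; last exact: sgk.
have [cw|cw] := eqVneq (dot c w) 0; last by rewrite (eq_sgr_eq0 (sgk w _ _)).
by rewrite linearDl linearZl_LR /= cw add0r mulf_neq0 ?(lt0r_neq0 k_gt0) ?e_gen.
Qed.

End Dot.

Section Segments.
Context {R : realType} {d : nat}.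
Implicit Types (u v x y : 'rV[R]_d).

Lemma line_pointE u v (t : R) : (1 - t) *: u + t *: v = u + t *: (v - u).
Proof. by rewrite scalerBl scale1r scalerBr -addrA [- _ + _]addrC. Qed.

Lemma segmentE u v :
  segment u v = [set u + t *: (v - u) | t in [set t : R | 0 <= t <= 1]].
Proof. by apply: eq_imagel => t _; exact: line_pointE. Qed.

Lemma segmentC u v : segment u v = segment v u.
Proof.
suff sub x y : segment x y `<=` segment y x by apply/seteqP; split; exact: sub.
move=> _ [t /andP[t_ge0 t_le1] <-].
by exists (1 - t); rewrite /= ?subr_ge0 ?t_le1 ?gerBl // subKr addrC.
Qed.

Lemma segment_left u v : segment u v u.
Proof.
by rewrite segmentE; exists 0; rewrite /= ?lexx ?ler01 // scale0r addr0.
Qed.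

Lemma segment_right u v : segment u v v.
Proof. by rewrite segmentC; exact: segment_left. Qed.

Lemma segment_sub_vline u v x y :
  segment u v x -> segment u v y -> x - y \in <[v - u]>%VS.
Proof.
rewrite segmentE => -[s _ <-] [t _ <-]; apply/vlineP; exists (s - t).
by rewrite opprD addrACA subrr add0r scalerBl.
Qed.

Lemma has_dim_segment u v : u != v -> has_dim (segment u v) 1.
Proof.
move=> uv; exists u, <[v - u]>%VS; split.
  by rewrite dim_vline subr_eq0 eq_sym uv.
apply/seteqP; split => y /=.
  move=> [n [w [x [x_seg w1 ->]]]]; exists (\sum_i w i *: (x i - u)).
    rewrite memv_suml // => i _; rewrite memvZ //.
    exact: segment_sub_vline (x_seg i) (segment_left u v).
  under eq_bigr do rewrite scalerBr.
  by rewrite sumrB -scaler_suml w1 scale1r subrKC.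
move=> [_ /vlineP[k ->] <-].
exists 2%N, (fun i : 'I_2 => if i == ord0 then 1 - k else k),
  (fun i : 'I_2 => if i == ord0 then u else v); split.
- by move=> i; case: eqP => _; [exact: segment_left|exact: segment_right].
- by rewrite !big_ord_recl big_ord0 /= addr0 subrK.
- by rewrite !big_ord_recl big_ord0 /= addr0 line_pointE.
Qed.

End Segments.

Lemma vline_not_free (K : fieldType) (V : vectType K) (u v w : V) :
  u \in <[w]>%VS -> v \in <[w]>%VS -> ~~ free [:: u; v].
Proof.
move=> uw vw; have /dimvS : (<<[:: u; v]>> <= <[w]>)%VS.
  by apply/span_subvP => x; rewrite !inE => /orP[]/eqP ->.
by apply: contraL => /eqP ->; rewrite dim_vline; case: eqP.
Qed.

Section PolytopeGraph.
Context {R : realType} {d : nat}.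
Implicit Types (P : set 'rV[R]_d) (u v w : 'rV[R]_d).

Lemma adjacent_sym P u v : adjacent P u v -> adjacent P v u.
Proof. by move=> [vert_u vert_v]; rewrite segmentC. Qed.

Lemma walk_cons P u v w n : adjacent P u v -> walk P v w n -> walk P u w n.+1.
Proof.
move=> uv [s [s_path s_last s_size]]; exists (v :: s); rewrite /= s_path s_size.
by split=> //; rewrite andbT; exact/asboolP.
Qed.

Lemma graph_dist_unique P u v m n :
  graph_dist P u v m -> graph_dist P u v n -> m = n.
Proof.
by move=> [wm min_m] [wn min_n]; apply/eqP; rewrite eqn_leq min_m ?min_n.
Qed.

Lemma diameter_eq P n : is_diameter P n -> diameter P = n.
Proof.
have le_diam k l : is_diameter P k -> is_diameter P l -> (k <= l)%N.
  move=> [_ [u [v [vert_u vert_v dist_k]]]] [dist_le _].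
  have [m dist_m] := dist_le u v vert_u vert_v.
  by rewrite (graph_dist_unique dist_k dist_m).
move=> diam_n; apply: xget_unique => // k diam_k.
by apply/eqP; rewrite eqn_leq !le_diam.
Qed.

Lemma box_size_eq P k : is_box_size P k -> box_size P = k.
Proof.
move=> [fit_k min_k]; apply: xget_unique => // l [fit_l min_l].
by apply/eqP; rewrite eq_le min_l // min_k.
Qed.

End PolytopeGraph.

Section Hamming.
Context {I : finType}.
Implicit Types (A B C : {set I}) (i : I).

Definition hamming A B : nat := #|[set i | (i \in A) (+) (i \in B)]%SET|.

Lemma hammingxx A : hamming A A = 0%N.
Proof. by apply: eq_card0 => i; rewrite inE addbb. Qed.

Lemma hamming_triangle A B C : (hamming A C <= hamming A B + hamming B C)%N.
Proof.
apply: leq_trans (leq_card_setU _ _).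
apply/subset_leq_card/fintype.subsetP => i.
by rewrite !inE; case: (i \in A) (i \in B) (i \in C) => [] [] [].
Qed.

Lemma hamming_setC A : hamming A (~: A) = #|I|.
Proof. by rewrite -cardsT; apply: eq_card => i; rewrite !inE addbN addbb. Qed.

Definition toggle i A : {set I} := [set j | (j \in A) (+) (j == i)]%SET.

Lemma toggle_setD1 i A :
  (A = A :\ i /\ toggle i A = i |: A :\ i)%SET \/
  (A = i |: A :\ i /\ toggle i A = A :\ i)%SET.
Proof.
by have [iA|iA] := boolP (i \in A); [right|left]; split; apply/setP => j;
  rewrite !inE; have [->|_] := eqVneq j i; rewrite ?(negbTE iA) ?iA ?addbF.
Qed.

Lemma hamming_toggle i A B :
  (i \in A) (+) (i \in B) -> hamming A B = (hamming (toggle i A) B).+1.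
Proof.
move=> iAB; rewrite /hamming (cardsD1 i) inE iAB; congr _.+1.
apply: eq_card => j; rewrite !inE.
have [->|_] := eqVneq j i; last by rewrite addbF.
by case: (i \in A) (i \in B) iAB => [] [].
Qed.

End Hamming.

Section Zonotope.
Context {R : realType} {d : nat} {I : finType}.
Variables (a : 'rV[R]_d) (g : I -> 'rV[R]_d).
Implicit Types (c x y u v : 'rV[R]_d) (t : I -> R) (A B : {set I}) (i j : I).

Definition unit_box : set (I -> R) := [set t | forall i, 0 <= t i <= 1].

Definition zono_point t : 'rV[R]_d := a + \sum_i t i *: g i.

Definition zono : set 'rV[R]_d := [set zono_point t | t in unit_box].

Definition indicator A i : R := (i \in A)%:R.

Definition corner A : 'rV[R]_d := zono_point (indicator A).

Definition positive_set c : {set I} := [set i | 0 < dot c (g i)]%SET.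

Definition top_corner c : 'rV[R]_d := corner (positive_set c).

Definition top_face c : set 'rV[R]_d :=
  zono `&` [set y | dot c y = dot c (top_corner c)].

Lemma eq_zono_point t t' : t =1 t' -> zono_point t = zono_point t'.
Proof. by move=> eq_t; congr (_ + _); apply: eq_bigr => i _; rewrite eq_t. Qed.

Lemma zono_pointD1 i t t' : (forall j, j != i -> t j = t' j) ->
  zono_point t = zono_point t' + (t i - t' i) *: g i.
Proof.
move=> eq_t; rewrite /zono_point -addrA; congr (_ + _).
rewrite (bigD1 i) // [in RHS](bigD1 i) //=.
under eq_bigr => j /eq_t -> do [].
by rewrite -{1}(subrK (t' i) (t i)) scalerDl -addrA addrC.
Qed.

Lemma cornerE A : corner A = a + \sum_(i in A) g i.
Proof.
congr (_ + _); rewrite [RHS]big_mkcond; apply: eq_bigr => i _.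
by rewrite /indicator; case: (i \in A); rewrite ?scale1r ?scale0r.
Qed.

Lemma corner_setU1 A i : i \notin A -> corner (i |: A) = corner A + g i.
Proof. by move=> iA; rewrite !cornerE big_setU1 //= addrCA addrC. Qed.

Lemma indicator_unit_box A : unit_box (indicator A).
Proof.
by move=> i; rewrite /indicator; case: (i \in A); rewrite ?lexx ?ler01.
Qed.

Lemma zono_corner A : zono (corner A).
Proof. by exists (indicator A); first exact: indicator_unit_box. Qed.

Lemma dot_gap c t : dot c (top_corner c) - dot c (zono_point t) =
  \sum_i (indicator (positive_set c) i - t i) * dot c (g i).
Proof.
rewrite !linearDr !linear_sumr opprD addrACA subrr add0r -sumrB.
by apply: eq_bigr => i _; rewrite !linearZr_LR mulrBl.
Qed.

Lemma dot_gap_term_ge0 c t i : unit_box t ->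
  0 <= (indicator (positive_set c) i - t i) * dot c (g i).
Proof.
move=> /(_ i)/andP[t_ge0 t_le1]; rewrite /indicator inE; case: ltP => ci.
  by rewrite mulr_ge0 ?subr_ge0 // ltW.
by rewrite sub0r mulr_le0 // oppr_le0.
Qed.

Lemma dot_le_top_corner c y : zono y -> dot c y <= dot c (top_corner c).
Proof.
move=> [t t01 <-]; rewrite -subr_ge0 dot_gap.
by apply: sumr_ge0 => i _; exact: dot_gap_term_ge0.
Qed.

Lemma dot_ge_top_corner c y : zono y -> dot c (top_corner (- c)) <= dot c y.
Proof. by move=> /(dot_le_top_corner (- c)); rewrite !linearNl lerN2. Qed.

Lemma dot_width c :
  dot c (top_corner c) - dot c (top_corner (- c)) = \sum_i `|dot c (g i)|.
Proof.
rewrite dot_gap; apply: eq_bigr => i _.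
rewrite /indicator !inE linearNl oppr_gt0.
by case: ltrgt0P => ci; rewrite ?subr0 ?mul1r ?sub0r ?mulN1r // ci mulr0.
Qed.

Lemma top_face_zono_pointP c t : unit_box t -> top_face c (zono_point t) <->
  forall i, dot c (g i) != 0 -> t i = indicator (positive_set c) i.
Proof.
move=> t01; split=> [[_ /esym/eqP]|t_eq].
  rewrite -subr_eq0 dot_gap psumr_eq0 => [/allP gap0 i ci|i _]; last first.
    exact: dot_gap_term_ge0.
  have := gap0 i (mem_index_enum _).
  by rewrite /= mulf_eq0 (negbTE ci) orbF subr_eq0 => /eqP.
split; first by exists t.
apply/esym/eqP; rewrite -subr_eq0 dot_gap big1 // => i _.
have [->|/t_eq ->] := eqVneq (dot c (g i)) 0; first by rewrite mulr0.
by rewrite subrr mul0r.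
Qed.

Lemma top_face_corner c A i :
  top_face c (corner A) -> dot c (g i) != 0 ->
  (i \in A) = (i \in positive_set c).
Proof.
move=> /(top_face_zono_pointP c (indicator_unit_box A)) A_eq /A_eq/eqP.
by rewrite /indicator eqr_nat; case: (i \in A) (i \in positive_set c) => [] [].
Qed.

Lemma top_face_top_corner c : top_face c (top_corner c).
Proof. by split=> //; exact: zono_corner. Qed.

Lemma orthogonal_notin c i : dot c (g i) = 0 -> i \notin positive_set c.
Proof. by move=> ci; rewrite inE ci ltxx. Qed.

Lemma top_face_setU1 c i :
  dot c (g i) = 0 -> top_face c (corner (i |: positive_set c)).
Proof.
move=> ci; split; first exact: zono_corner.
by rewrite /= corner_setU1 ?orthogonal_notin // linearDr /= ci addr0.
Qed.

Lemma face_top_face c : face zono (top_face c).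
Proof.
by exists c, (dot c (top_corner c)); split=> // y; exact: dot_le_top_corner.
Qed.

Lemma face_zono_top_face F :
  face zono F -> F !=set0 -> exists c, F = top_face c.
Proof.
move=> [c [b [le_b ->]]] [y [zy cy]]; exists c; rewrite /top_face.
suff -> : dot c (top_corner c) = b by [].
by apply/eqP; rewrite eq_le (le_b _ (zono_corner _)) -cy dot_le_top_corner.
Qed.

Definition generic c : Prop := forall i, dot c (g i) != 0.

(* The sets [positive_set c], for generic [c], label the chambers of the
   arrangement of hyperplanes orthogonal to the generators. *)
Definition chamber A : Prop := exists2 c, generic c & A = positive_set c.

Definition wall i c : Prop := forall j, (dot c (g j) == 0) = (j == i).

Lemma chamber_setC A : chamber A -> chamber (~: A).
Proof.
move=> [c gen_c ->]; exists (- c) => [i|].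
  by rewrite linearNl oppr_eq0; exact: gen_c.
apply/setP => i; rewrite !inE linearNl oppr_gt0.
by have := gen_c i; case: ltrgt0P.
Qed.

Lemma top_face_generic c : generic c -> top_face c = [set top_corner c].
Proof.
move=> gen_c; apply/seteqP; split => [y top_y|_ ->]; last first.
  exact: top_face_top_corner.
have [t t01 ty] := top_y.1; rewrite -ty in top_y *; apply: eq_zono_point => i.
by have /(top_face_zono_pointP c t01) -> := top_y.
Qed.

Lemma vertex_corner A : chamber A -> vertex zono (corner A).
Proof.
move=> [c gen_c ->]; rewrite /vertex -(top_face_generic gen_c).
exact: face_top_face.
Qed.

Lemma corner_inj_chamber A B : chamber A -> corner B = corner A -> B = A.
Proof.
move=> [c gen_c ->] eq_top; apply/setP => i; apply: top_face_corner => //.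
by rewrite eq_top; exact: top_face_top_corner.
Qed.

Lemma wall_dot0 i c : wall i c -> dot c (g i) = 0.
Proof. by move=> wall_c; apply/eqP; rewrite wall_c. Qed.

Lemma wall_notin i c : wall i c -> i \notin positive_set c.
Proof. by move=> /wall_dot0; exact: orthogonal_notin. Qed.

Lemma top_face_wall i c : wall i c ->
  top_face c = segment (corner (positive_set c)) (corner (i |: positive_set c)).
Proof.
move=> wall_c; have iNP := wall_notin wall_c; set P := positive_set c in iNP *.
rewrite segmentE corner_setU1 // addrAC subrr add0r.
apply/seteqP; split => [y top_y|_ [s s01 <-]].
  have [t t01 ty] := top_y.1; rewrite -ty in top_y *.
  have t_eq j : j != i -> t j = indicator P j.
    rewrite -wall_c.
    by have /(top_face_zono_pointP c t01)/(_ j) := top_y.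
  exists (t i); first exact: t01.
  by rewrite (zono_pointD1 t_eq) /indicator (negbTE iNP) subr0.
pose t j := if j == i then s else indicator P j.
have -> : corner P + s *: g i = zono_point t.
  rewrite (@zono_pointD1 i t (indicator P)) => [|j ji]; last first.
    by rewrite /t (negbTE ji).
  by rewrite /t eqxx /indicator (negbTE iNP) subr0.
apply/top_face_zono_pointP => j; rewrite /t ?wall_c; last by move/negbTE ->.
by case: eqP => _; [exact: s01|exact: indicator_unit_box].
Qed.

Lemma chamber_near_wall i c v : wall i c -> dot v (g i) != 0 ->
  chamber (if 0 < dot v (g i) then i |: positive_set c else positive_set c).
Proof.
move=> wall_c vi; have [k k_gt0 sgk] := sgr_dot_perturb (codom g) c v.
have {}sgk j : j != i -> Num.sg (dot (c + k *: v) (g j)) = Num.sg (dot c (g j)).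
  by rewrite -wall_c => cj; rewrite sgk ?codom_f.
have dot_i : dot (c + k *: v) (g i) = k * dot v (g i).
  by rewrite linearDl linearZl_LR /= wall_dot0 ?add0r.
exists (c + k *: v) => [j|].
  have [->|ji] := eqVneq j i.
    by rewrite dot_i mulf_neq0 ?(lt0r_neq0 k_gt0).
  by rewrite (eq_sgr_eq0 (sgk j ji)) wall_c.
apply/setP => j; rewrite [RHS]inE; have [->|ji] := eqVneq j i.
  rewrite dot_i pmulr_rgt0 //; case: ifP => _; first by rewrite setU11.
  exact/negbTE/wall_notin.
by rewrite (eq_sgr_gt0 (sgk j ji)); case: ifP; rewrite !inE // (negbTE ji).
Qed.

Lemma wall_chambers i c : g i != 0 -> wall i c ->
  chamber (positive_set c) /\ chamber (i |: positive_set c).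
Proof.
move=> /dot_gt0 gi wall_c; split.
  have := @chamber_near_wall i c (- g i) wall_c.
  by rewrite linearNl oppr_eq0 oppr_gt0 ltNge (ltW gi) gt_eqF //=; exact.
by have := @chamber_near_wall i c (g i) wall_c; rewrite gi gt_eqF //; exact.
Qed.

Lemma adjacent_wall i c : g i != 0 -> wall i c ->
  adjacent zono (corner (positive_set c)) (corner (i |: positive_set c)).
Proof.
move=> gi_neq0 wall_c; have [cP ciP] := wall_chambers gi_neq0 wall_c.
split; [exact: vertex_corner..|split].
  by rewrite -top_face_wall //; exact: face_top_face.
apply: has_dim_segment; rewrite corner_setU1 ?wall_notin // -subr_eq0.
by rewrite opprD addrA subrr add0r oppr_eq0.
Qed.

Definition pairwise_free : Prop :=
  (forall i, g i != 0) /\ (forall i j, i != j -> free [:: g i; g j]).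

Lemma positive_set_addb c c' i : generic c -> generic c' ->
  (i \in positive_set c) (+) (i \in positive_set c') =
  (dot c (g i) * dot c' (g i) < 0).
Proof.
move=> /(_ i) + /(_ i); rewrite !inE.
case: (ltrgt0P (dot c (g i))) => // ci _;
  case: (ltrgt0P (dot c' (g i))) => // c'i _.
- by rewrite pmulr_rlt0 // ltNge ltW.
- by rewrite pmulr_rlt0.
- by rewrite nmulr_rlt0.
- by rewrite nmulr_rlt0 // ltNge ltW.
Qed.

Hypothesis g_free : pairwise_free.

Let g_neq0 i : g i != 0. Proof. exact: g_free.1. Qed.

Lemma vertex_zono_corner v :
  vertex zono v -> exists2 A, chamber A & v = corner A.
Proof.
move=> face_v; have [|c vE] := face_zono_top_face face_v; first by exists v.
have eq_v y : top_face c y -> y = v by rewrite -vE.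
have top_v : top_corner c = v by exact/eq_v/top_face_top_corner.
exists (positive_set c) => //; exists c => // i; apply/negP => /eqP ci.
have := eq_v _ (top_face_setU1 ci).
rewrite corner_setU1 ?orthogonal_notin // -[corner _]/(top_corner c) top_v.
by rewrite -[RHS]addr0 => /addrI/eqP; rewrite (negbTE (g_neq0 i)).
Qed.

Lemma adjacent_hamming A B :
  adjacent zono (corner A) (corner B) -> (hamming A B <= 1)%N.
Proof.
move=> [_ _ [/face_zono_top_face face_AB _]].
have [|c segE] := face_AB; first by exists (corner A); exact: segment_left.
have orth i : (i \in A) (+) (i \in B) -> dot c (g i) = 0.
  move=> iAB; apply/eqP; apply: contraTT iAB => ci.
  rewrite (@top_face_corner c A i) ?(@top_face_corner c B i) ?addbb // -segE.
    exact: segment_right.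
  exact: segment_left.
have parallel i : dot c (g i) = 0 -> g i \in <[corner B - corner A]>%VS.
  move=> ci; rewrite -[g i](addKr (top_corner c)) addrC.
  rewrite -corner_setU1 ?orthogonal_notin //.
  apply: segment_sub_vline; rewrite segE; first exact: top_face_setU1.
  exact: top_face_top_corner.
apply/card_le1_eqP => i j; rewrite !inE => /orth/parallel iw /orth/parallel jw.
apply/eqP; rewrite eq_sym; apply: contraT => /g_free.2.
by rewrite (negbTE (vline_not_free iw jw)).
Qed.

Lemma walk_hamming A B n : chamber A -> chamber B ->
  walk zono (corner A) (corner B) n -> (hamming A B <= n)%N.
Proof.
move=> chamber_A chamber_B [s [+ + <-]].
elim: s A chamber_A => [|x s IH] A chamber_A /=.
  by move=> _ /(corner_inj_chamber chamber_B) ->; rewrite hammingxx.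
move=> /andP[/asboolP Ax xs] last_s; have [_ vert_x _] := Ax.
have [C chamber_C xE] := vertex_zono_corner vert_x; rewrite xE in Ax xs last_s.
rewrite -add1n (leq_trans (hamming_triangle A C B)) //.
by rewrite leq_add ?adjacent_hamming ?IH.
Qed.

(* The ray [c0 + r *: c] may cross several of the hyperplanes at the same time;
   moving [c] inside its chamber separates the crossings. *)
Lemma exists_transverse c0 B : generic c0 -> chamber B ->
  exists c, [/\ generic c, positive_set c = B & forall i j, i != j ->
    dot c0 (g i) * dot c (g j) != dot c0 (g j) * dot c (g i)].
Proof.
move=> gen_c0 [c1 gen_c1 ->].
pose W i j := dot c0 (g i) *: g j - dot c0 (g j) *: g i.
have [c near_c] :=
  exists_generic_near (codom g ++ [seq W i j | i <- enum I, j <- enum I]) c1.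
have sg_c i : Num.sg (dot c (g i)) = Num.sg (dot c1 (g i)).
  have [|_ sg_near] := near_c (g i); first by rewrite mem_cat codom_f.
  by apply: sg_near; exact: gen_c1.
exists c; split=> [i||i j ij].
- by rewrite (eq_sgr_eq0 (sg_c i)); exact: gen_c1.
- by apply/setP => i; rewrite !inE (eq_sgr_gt0 (sg_c i)).
have [|near_W _] := near_c (W i j).
  by rewrite mem_cat; apply/orP; right; apply: allpairs_f; rewrite mem_enum.
suff /near_W : W i j != 0 by rewrite linearBr !linearZr_LR subr_eq0.
rewrite subr_eq0; apply: contraTneq (g_free.2 i j ij) => gij.
rewrite free_cons seq1_free span_seq1 g_neq0 andbT negbK; apply/vlineP.
exists ((dot c0 (g j))^-1 * dot c0 (g i)).
by rewrite -scalerA gij scalerA mulVf ?scale1r //; exact: gen_c0.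
Qed.

Lemma first_wall A B : chamber A -> chamber B -> A != B ->
  exists i c, [/\ (i \in A) (+) (i \in B), wall i c & positive_set c = A :\ i].
Proof.
move=> [c0 gen_c0 ->] chamber_B AB.
have [c [gen_c cB cross]] := exists_transverse gen_c0 chamber_B.
have [i0] : exists i, (i \in positive_set c0) (+) (i \in B).
  apply/existsP; apply: contraNT AB => /existsPn same; apply/eqP/setP => i.
  by have := same i; case: (i \in positive_set c0) (i \in B) => [] [].
rewrite -cB (positive_set_addb _ gen_c0 gen_c) => i0D.
have [i [r [iD root_i sg_e]]] := first_sign_change gen_c0 cross i0D.
have dot_e j : dot (c0 + r *: c) (g j) = dot c0 (g j) + r * dot c (g j).
  by rewrite linearDl linearZl_LR.
exists i, (c0 + r *: c); split; first by rewrite positive_set_addb.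
- move=> j; have [->|ji] := eqVneq j i; first by rewrite dot_e root_i eqxx.
  by rewrite dot_e (eq_sgr_eq0 (sg_e j ji)) (negbTE (gen_c0 j)).
apply/setP => j; rewrite !inE dot_e; have [->|ji] := eqVneq j i.
  by rewrite root_i ltxx.
by rewrite (eq_sgr_gt0 (sg_e j ji)).
Qed.

Lemma chamber_toggle i c A :
  wall i c -> positive_set c = A :\ i -> chamber (toggle i A).
Proof.
move=> wall_c cA; have [] := wall_chambers (g_neq0 i) wall_c.
by rewrite cA; case: (toggle_setD1 i A) => -[_ ->].
Qed.

Lemma adjacent_toggle i c A : wall i c -> positive_set c = A :\ i ->
  adjacent zono (corner A) (corner (toggle i A)).
Proof.
move=> wall_c cA; have := adjacent_wall (g_neq0 i) wall_c; rewrite cA.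
case: (toggle_setD1 i A) => -[A_eq ->]; first by rewrite -A_eq.
by rewrite -A_eq => /adjacent_sym.
Qed.

(* Every chamber is joined to [B] by a gallery, each step of which crosses a
   wall separating it from [B]. *)
Lemma chamber_gallery_ind B (Q : {set I} -> Prop) : chamber B -> Q B ->
    (forall i c A, (i \in A) (+) (i \in B) -> wall i c ->
       positive_set c = A :\ i -> Q (toggle i A) -> Q A) ->
  forall A, chamber A -> Q A.
Proof.
move=> chamber_B QB Q_step A; have [n] := ubnP (hamming A B).
elim: n A => // n IH A; rewrite ltnS => An chamber_A.
have [->//|AB] := eqVneq A B.
have [i [c [iAB wall_c cA]]] := first_wall chamber_A chamber_B AB.
apply: (Q_step i c A) => //; apply: IH; first by rewrite -hamming_toggle.
exact: chamber_toggle wall_c cA.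
Qed.

Lemma exists_chamber : exists A, chamber A.
Proof.
have [c gen_c] := exists_generic (codom g).
by exists (positive_set c), c => // i; rewrite gen_c ?codom_f.
Qed.

Lemma exists_wall i : exists c, wall i c.
Proof.
have [A chamber_A] := exists_chamber.
suff wall_i : forall B, chamber B ->
    (i \in B) (+) (i \in ~: A) -> exists c, wall i c.
  by apply: (wall_i A) => //; rewrite inE addbN addbb.
apply: (chamber_gallery_ind (chamber_setC chamber_A)) => [|j c C _ wall_c _ IH].
  by rewrite addbb.
have [->|ij] := eqVneq i j; first by exists c.
by move=> iC; apply: IH; rewrite inE (negbTE ij) addbF.
Qed.

Lemma walk_corner A B : chamber A -> chamber B ->
  walk zono (corner A) (corner B) (hamming A B).
Proof.
move=> chamber_A chamber_B; move: A chamber_A.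
apply: (chamber_gallery_ind chamber_B) => [|i c C iCB wall_c cC].
  by rewrite hammingxx; exists [::].
rewrite (hamming_toggle iCB); apply: walk_cons.
exact: adjacent_toggle wall_c cC.
Qed.

Lemma diameter_zono : diameter zono = #|I|.
Proof.
have dist A B : chamber A -> chamber B ->
    graph_dist zono (corner A) (corner B) (hamming A B).
  by move=> cA cB; split=> [|n]; [exact: walk_corner|exact: walk_hamming].
apply: diameter_eq; split.
  move=> u v /vertex_zono_corner[A cA ->] /vertex_zono_corner[B cB ->].
  by exists (hamming A B); [exact: dist|exact: max_card].
have [A cA] := exists_chamber; have cNA := chamber_setC cA.
exists (corner A), (corner (~: A)); rewrite -(hamming_setC A).
by split; [exact: vertex_corner..|exact: dist].
Qed.

End Zonotope.

Section LatticeVectors.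
Context {d : nat}.
Implicit Types (x y z : 'rV[int]_d) (m : int).

Definition content z : nat := \big[gcdn/0%N]_(i < d) `|z ord0 i|%N.

Lemma contentZ m z : content (m *: z) = (`|m| * content z)%N.
Proof.
rewrite /content (big_morph _ (muln_gcdr `|m|%N) (muln0 _)).
by apply: eq_bigr => i _; rewrite mxE abszM.
Qed.

Lemma primitiveN z : primitive z -> primitive (- z).
Proof.
move=> [z_neq0 z1]; split; first by rewrite oppr_eq0.
by rewrite -scaleN1r -/(content _) contentZ mul1n.
Qed.

Lemma norm1N z : norm1 (- z) = norm1 z.
Proof. by apply: eq_bigr => i _; rewrite mxE normrN. Qed.

Lemma norm1Z m z : norm1 (m *: z) = `|m| * norm1 z.
Proof.
by rewrite /norm1 mulr_sumr; apply: eq_bigr => i _; rewrite mxE normrM.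
Qed.

Lemma norm1_gt0 z : z != 0 -> 0 < norm1 z.
Proof.
move=> /rV0Pn[i zi].
by rewrite /norm1 (bigD1 i) //= ltr_pwDl ?normr_gt0 ?sumr_ge0.
Qed.

Lemma le_norm1Z m z : m != 0 -> norm1 z <= norm1 (m *: z).
Proof.
by move=> m_neq0; rewrite norm1Z ler_peMl ?sumr_ge0 // -gtz0_ge1 normr_gt0.
Qed.

Lemma norm1Z_eq m z : norm1 (m *: z) = norm1 z -> m *: z = z \/ m *: z = - z.
Proof.
have [->|z_neq0] := eqVneq z 0; first by rewrite scaler0; left.
rewrite norm1Z -[RHS]mul1r => /(mulIf (lt0r_neq0 (norm1_gt0 z_neq0)))/eqP.
rewrite eqr_norml ler01 andbT => /orP[]/eqP ->; first by rewrite scale1r; left.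
by rewrite scaleN1r; right.
Qed.

Lemma first_nonzero_pos_total z :
  z != 0 -> first_nonzero_pos z \/ first_nonzero_pos (- z).
Proof.
move=> /rV0Pn[i0 zi0].
have [i zi i_min] :=
  arg_minnP (P := fun i => z ord0 i != 0) (@nat_of_ord d) zi0.
have z0 (j : 'I_d) : (j < i)%N -> z ord0 j = 0.
  by move=> ji; apply/eqP; apply: contraTT ji => /i_min; rewrite -leqNgt.
case: (ltrgt0P (z ord0 i)) zi => // zi _; [left|right]; exists i.
  by split.
by rewrite mxE oppr_gt0; split=> // j /z0; rewrite mxE => ->; rewrite oppr0.
Qed.

Lemma first_nonzero_posN z : first_nonzero_pos z -> ~ first_nonzero_pos (- z).
Proof.
move=> [i [zi z0]] [j []]; rewrite mxE oppr_gt0 => zj zN0.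
have [ij|ji|/ord_inj ij] := ltngtP i j.
- by have /eqP := zN0 i ij; rewrite mxE oppr_eq0 gt_eqF.
- by rewrite z0 ?ltxx in zj.
- by rewrite ij ltNge ltW in zi.
Qed.

Lemma parallel_primitive x y : primitive x -> primitive y ->
    (forall i j, x ord0 i * y ord0 j = x ord0 j * y ord0 i) ->
  x = y \/ x = - y.
Proof.
move=> [/rV0Pn[i xi] x1] [_ y1] minors0.
have scale_eq j : y ord0 j *: x = x ord0 j *: y.
  by apply/rowP => k; rewrite !mxE mulrC minors0.
have abs_eq j : `|x ord0 j|%N = `|y ord0 j|%N.
  have := congr1 content (scale_eq j).
  by rewrite !contentZ /content x1 y1 !muln1.
have scaler_xi : injective (fun z => x ord0 i *: z).
  move=> u v /rowP uv; apply/rowP => j.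
  by have := uv j; rewrite !mxE => /(mulfI xi).
have /orP[] : (x ord0 i == y ord0 i) || (x ord0 i == - y ord0 i).
  by rewrite -eqr_norm2 -!abszE abs_eq.
- by move/eqP => xy; left; apply: scaler_xi; rewrite /= -scale_eq -xy.
- move/eqP => xy; right; apply: scaler_xi.
  by rewrite /= scalerN -scale_eq -scaleNr -xy.
Qed.

Definition canonical_primitive z : Prop := primitive z /\ first_nonzero_pos z.

Lemma parallel_canonical_primitive x y :
    canonical_primitive x -> canonical_primitive y ->
    (forall i j, x ord0 i * y ord0 j = x ord0 j * y ord0 i) -> x = y.
Proof.
move=> [px fx] [py fy] /(parallel_primitive px py)[//|xNy].
by rewrite xNy in fx; have := first_nonzero_posN fy fx.
Qed.

Lemma canonical_primitive_multiple z : z != 0 ->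
  exists x m, [/\ canonical_primitive x, m != 0 & z = m *: x].
Proof.
move=> z_neq0; pose x : 'rV[int]_d := \row_i (z ord0 i %/ (content z)%:Z)%Z.
have zE : z = (content z)%:Z *: x.
  by apply/rowP => i; rewrite !mxE mulrC divzK // dvdzE (biggcdn_inf i).
have c_neq0 : content z != 0%N.
  by apply: contra z_neq0 => /eqP c0; rewrite zE c0 scale0r.
have x_neq0 : x != 0 by apply: contra z_neq0 => /eqP x0; rewrite zE x0 scaler0.
have prim_x : primitive x.
  split=> //; apply/eqP; rewrite -(@eqn_pmul2l (content z)) ?lt0n // muln1.
  by rewrite -/(content x) -[X in (X * _)%N]absz_nat -contentZ -zE.
have [fst_x|fst_xN] := first_nonzero_pos_total x_neq0.
  by exists x, (content z)%:Z.
exists (- x), (- (content z)%:Z).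
split; last by rewrite scalerN scaleNr opprK.
  by split=> //; exact: primitiveN.
by rewrite oppr_eq0.
Qed.

Lemma finite_norm1_ball (p : nat) :
  finite_set [set z : 'rV[int]_d | norm1 z <= p%:Z].
Proof.
pose shift (k : 'I_(p + p).+1) : int := (k : nat)%:Z - p%:Z.
pose f (u : 'rV['I_(p + p).+1]_d) : 'rV[int]_d := map_mx shift u.
apply: (@sub_finite_set _ _ (range f)); last exact/finite_image/finite_finset.
move=> z /= zp; exists (map_mx (fun m => inord (absz (m + p%:Z))) z) => //.
apply/rowP => i; rewrite !mxE /shift.
have : `|z ord0 i| <= p%:Z.
  by apply: le_trans zp; rewrite /norm1 (bigD1 i) //= lerDl sumr_ge0.
rewrite ler_norml => /andP[zi_ge zi_le].
have zip_ge0 : 0 <= z ord0 i + p%:Z by rewrite -lerBlDr sub0r.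
by rewrite inordK ?gez0_abs ?addrK // ltnS -lez_nat gez0_abs // PoszD lerD2r.
Qed.

Lemma H1_generators_finite (p : nat) : finite_set (@H1_generators d p).
Proof. by apply: sub_finite_set (finite_norm1_ball p) => z []. Qed.

Definition H1_gens (p : nat) : {fset 'rV[int]_d} := fset_set (H1_generators p).

Lemma H1_gensP (p : nat) z : z \in H1_gens p <-> H1_generators p z.
Proof.
by rewrite /H1_gens in_fset_set ?in_setE //; exact: H1_generators_finite.
Qed.

Lemma H1_gens_set_bij (p : nat) :
  set_bij [set: H1_gens p] (H1_generators p) val.
Proof.
split=> [z _|x y _ _ /val_inj //|z /H1_gensP zH]; first exact/H1_gensP/valP.
by exists [` zH]%fset.
Qed.

Lemma fsbig_H1_generators (p : nat) (V : nmodType) (F : 'rV[int]_d -> V) :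
  \sum_(z \in H1_generators p) F z = \sum_(z <- H1_gens p) F z.
Proof. exact/fsbig_finite/H1_generators_finite. Qed.

Definition primitive_ball (p : nat) : set 'rV[int]_d :=
  [set z | primitive z /\ norm1 z <= p%:Z].

Lemma primitive_ballE (p : nat) :
  primitive_ball p = H1_generators p `|` [set - z | z in H1_generators p].
Proof.
apply/seteqP; split=> [z [prim_z zp]|z].
  have [fst_z|fst_zN] := first_nonzero_pos_total prim_z.1; [left|right] => //.
  exists (- z); rewrite ?opprK //.
  by split; [exact: primitiveN|rewrite norm1N|].
case=> [[prim_z zp _]|[y [/primitiveN prim_y yp _] <-]]; first by split.
by split; rewrite ?norm1N.
Qed.

Lemma primitive_ball_col_perm (p : nat) (s : 'S_d) z :
  primitive_ball p z -> primitive_ball p (col_perm s z).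
Proof.
have reindex_s (V : Type) (idx : V) (op : Monoid.com_law idx) (F : int -> V) :
    \big[op/idx]_i F (col_perm s z ord0 i) = \big[op/idx]_i F (z ord0 i).
  by rewrite [RHS](reindex_perm s); apply: eq_bigr => i _; rewrite mxE.
move=> [[z_neq0 z1] zp].
split; last by rewrite /norm1 (reindex_s _ _ _ Num.norm).
split; last by rewrite (reindex_s _ _ _ absz).
apply: contra z_neq0 => /eqP sz0.
by rewrite -[z]col_perm1 -(mulVg s) col_permM sz0 raddf0.
Qed.

Lemma fsum_primitive_ball (p : nat) (K : numDomainType) (F : 'rV[int]_d -> K) :
    (forall z, F (- z) = F z) ->
  \sum_(z \in primitive_ball p) F z = (\sum_(z \in H1_generators p) F z) *+ 2.
Proof.
move=> F_even; have fin := H1_generators_finite p.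
rewrite primitive_ballE fsbigU; [|exact: fin|exact: finite_image|]; last first.
  move=> z [[_ _ fst_z] [y [_ _ fst_y] yz]]; rewrite -yz in fst_z.
  by have := first_nonzero_posN fst_y fst_z.
rewrite fsbig_image => [|x y _ _]; last exact: oppr_inj.
by rewrite mulr2n; congr (_ + _); apply: eq_fsbigr => z _; rewrite F_even.
Qed.

Lemma fsum_H1_generators_col_perm (p : nat) (s : 'S_d) (K : numDomainType)
    (F : 'rV[int]_d -> K) : (forall z, F (- z) = F z) ->
  \sum_(z \in H1_generators p) F (col_perm s z) =
  \sum_(z \in H1_generators p) F z.
Proof.
move=> F_even; apply: (@pmulrnI _ 2) => //=.
have Fs_even z : F (col_perm s (- z)) = F (col_perm s z).
  by rewrite raddfN F_even.
rewrite -(fsum_primitive_ball _ F_even) -(fsum_primitive_ball _ Fs_even).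
have col_permK (t : 'S_d) : cancel (@col_perm int 1 d t) (col_perm t^-1%g).
  by move=> z; rewrite -col_permM mulVg col_perm1.
apply/esym/reindex_fsbig; split=> [z|x y _ _|z prim_z].
- exact: primitive_ball_col_perm.
- exact: (can_inj (col_permK s)).
- exists (col_perm s^-1%g z); first exact: primitive_ball_col_perm.
  by rewrite -{1}[s]invgK col_permK.
Qed.

Lemma fsum_H1_generators_coord (p : nat) (i j : 'I_d) :
  \sum_(z <- H1_gens p) `|z ord0 i| = \sum_(z <- H1_gens p) `|z ord0 j|.
Proof.
rewrite -!fsbig_H1_generators.
rewrite -(@fsum_H1_generators_col_perm p (tperm i j) _ (fun z => `|z ord0 j|)).
  by apply: eq_fsbigr => z _; rewrite mxE tpermR.
by move=> z; rewrite mxE normrN.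
Qed.

End LatticeVectors.

Arguments H1_gens d p : clear implicits.

Section FsetSums.
Context {T : choiceType} {K : realDomainType}.
Implicit Types (A B : {fset T}) (f : T -> K).

Lemma sumr_fset_subD A B f :
  \sum_(z <- A) f z - \sum_(z <- B) f z =
  \sum_(z <- A | z \notin B) f z - \sum_(z <- B | z \notin A) f z.
Proof.
rewrite (bigID (mem B)) [X in _ - X](bigID (mem A)) /=.
have -> : \sum_(z <- B | z \in A) f z = \sum_(z <- A | z \in B) f z.
  rewrite big_fset_condE [RHS]big_fset_condE; congr (\sum_(z <- _) f z).
  by congr enum_fset; apply/fsetP => z; rewrite !inE andbC.
by rewrite opprD addrACA subrr add0r.
Qed.

Lemma ler_sum_fset A B f : (forall z, z \in A -> f z <= 0) ->
  (forall z, z \in B -> z \notin A -> 0 <= f z) ->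
  \sum_(z <- A) f z <= \sum_(z <- B) f z.
Proof.
move=> fA fB; rewrite -subr_ge0 sumr_fset_subD subr_ge0 (@le_trans _ _ 0) //.
  by rewrite big_seq_cond sumr_le0 // => z /andP[/fA].
by rewrite big_seq_cond sumr_ge0 // => z /andP[/fB].
Qed.

Lemma fsubset_of_ler_sum A B f : (forall z, z \in A -> f z <= 0) ->
  (forall z, z \in B -> z \notin A -> 0 < f z) ->
  \sum_(z <- B) f z <= \sum_(z <- A) f z -> (B `<=` A)%fset.
Proof.
move=> fA fB; rewrite -subr_le0 sumr_fset_subD subr_le0 => le_BA.
have sum_le0 : \sum_(z <- B | z \notin A) f z <= 0.
  by apply: le_trans le_BA _; rewrite big_seq_cond sumr_le0 // => z /andP[/fA].
apply/fsubsetP => z zB; apply: contraTT sum_le0 => zNA; rewrite -ltNge.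
rewrite big_mkcond (big_fsetD1 z) //= zNA ltr_pwDl ?fB //.
rewrite big_seq sumr_ge0 // => y; rewrite !inE => /andP[_ yB].
by case: ifPn => // yNA; rewrite ltW ?fB.
Qed.

End FsetSums.

Definition total_norm1 {d : nat} (A : {fset 'rV[int]_d}) : int :=
  \sum_(z <- A) norm1 (z : 'rV[int]_d).

Section PrimitiveFamilies.
Context {d p : nat} {I : finType}.
Variable x : I -> 'rV[int]_d.
Hypothesis x_inj : injective x.
Hypothesis x_primitive : forall i, canonical_primitive (x i).

Let X : {fset 'rV[int]_d} := [fset x i | i in I]%fset.

Let card_X : #|` X| = #|I|.
Proof. by rewrite card_imfset //= -cardE. Qed.

Let total_norm1_X : total_norm1 X = \sum_i norm1 (x i).
Proof.
by rewrite /total_norm1 big_imfset /= ?big_enum // => i j _ _; exact: x_inj.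
Qed.

(* [norm1 z - p] is nonpositive on [H1_gens d p] and positive on all other
   canonical primitive vectors. *)
Let excess (z : 'rV[int]_d) : int := norm1 z - p%:Z.

Let excess_H1 z : z \in H1_gens d p -> excess z <= 0.
Proof. by move=> /H1_gensP[_ zp _]; rewrite subr_le0. Qed.

Let excess_X z : z \in X -> z \notin H1_gens d p -> 0 < excess z.
Proof.
move=> /imfsetP[i _ ->]; apply: contraNT; rewrite -leNgt subr_le0 => xp.
by apply/H1_gensP; have [] := x_primitive i.
Qed.

Let sum_excess (A : {fset 'rV[int]_d}) :
  \sum_(z <- A) excess z = total_norm1 A - p%:Z * #|` A|%:Z.
Proof.
by rewrite sumrB big_const_seq iter_addr_0 count_predT -mulr_natr natz.
Qed.

Lemma total_norm1_H1_gens_le_primitive :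
  total_norm1 (H1_gens d p) + p%:Z * (#|I|%:Z - #|` H1_gens d p|%:Z) <=
  \sum_i norm1 (x i).
Proof.
rewrite -card_X -total_norm1_X.
have := ler_sum_fset excess_H1 (fun z zX zNH => ltW (excess_X zX zNH)).
by rewrite !sum_excess; lra.
Qed.

Lemma primitive_set_bij_H1_generators : #|I| = #|` H1_gens d p| ->
    \sum_i norm1 (x i) <= total_norm1 (H1_gens d p) ->
  set_bij [set: I] (H1_generators p) x.
Proof.
rewrite -card_X -total_norm1_X => cardX le_sum.
have XH : (X `<=` H1_gens d p)%fset.
  apply: (fsubset_of_ler_sum excess_H1 excess_X).
  by rewrite !sum_excess cardX lerD2r.
have {}XH : X = H1_gens d p.
  by apply/eqP; rewrite -(fsubset_leqif_cards XH) cardX.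
split=> [i _|i j _ _ /x_inj//|z /H1_gensP]; rewrite -?XH.
  by apply/H1_gensP; rewrite -XH; apply/imfsetP; exists i.
by move=> /imfsetP[i _ ->]; exists i.
Qed.

End PrimitiveFamilies.

Section ZonotopeTransformations.
Context {R : realType} {d : nat} {I : finType}.
Implicit Types (a b : 'rV[R]_d) (g : I -> 'rV[R]_d).

Lemma zono_translate a b g : zono (b + a) g = translate b (zono a g).
Proof.
apply/seteqP; split => [_ [t t01 <-]|_ [_ [t t01 <-] <-]].
  by exists (zono_point a g t); [exists t|rewrite /zono_point addrA].
by exists t; rewrite // /zono_point addrA.
Qed.

Lemma zono_flip (S : {set I}) a g :
  zono a (fun i => if i \in S then - g i else g i) =
  zono (a - \sum_(i in S) g i) g.
Proof.
pose flip (t : I -> R) i := if i \in S then 1 - t i else t i.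
have flip01 t : unit_box t -> unit_box (flip t).
  by move=> t01 i; have := t01 i; rewrite /flip; case: ifP => _; lra.
have flipK t : flip (flip t) =1 t.
  by move=> i; rewrite /flip; case: (i \in S); rewrite ?subKr.
have point_flip t : zono_point (a - \sum_(i in S) g i) g (flip t) =
    zono_point a (fun i => if i \in S then - g i else g i) t.
  rewrite /zono_point -addrA -sumrN; congr (_ + _).
  rewrite [X in X + _]big_mkcond -big_split; apply: eq_bigr => i _ /=.
  rewrite /flip; case: ifP => _; last by rewrite add0r.
  by rewrite scalerBl scale1r scalerN addKr.
apply/seteqP; split=> _ [t t01 <-]; exists (flip t) => //; try exact: flip01.
by rewrite -point_flip; apply: eq_zono_point.
Qed.

End ZonotopeTransformations.

Section MinkowskiSums.
Context {R : realType} {d : nat}.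

Lemma minkowski_sum_segments (T : choiceType) (D : set T) (I : finType)
    (h : I -> T) (u v : T -> 'rV[R]_d) : set_bij [set: I] D h ->
  minkowski_sum D (fun x => segment (u x) (v x)) =
  zono (\sum_i u (h i)) (fun i => v (h i) - u (h i)).
Proof.
move=> h_bij; have [h_D h_inj h_surj] := h_bij.
have sumE (f : T -> 'rV[R]_d) : \sum_(x \in D) f x = \sum_i f (h i).
  rewrite (reindex_fsbig _ _ _ _ h_bij) (fsbig_seq _ _ (index_enum_uniq I)).
  by apply: eq_fsbigl; apply/seteqP; split => i //= _; exact: mem_index_enum.
apply/seteqP; split => [_ [f f_seg ->]|_ [t t01 <-]].
  have /choice[t t_f] i : exists t : R, 0 <= t <= 1 /\
      u (h i) + t *: (v (h i) - u (h i)) = f (h i).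
    by have := f_seg _ (h_D i Logic.I); rewrite segmentE => -[t]; exists t.
  exists t => [i|]; first by case: (t_f i).
  by rewrite sumE /zono_point -big_split; apply: eq_bigr => i _; case: (t_f i).
pose f x :=
  if [pick i | h i == x] is Some i then u x + t i *: (v x - u x) else 0.
have fE i : f (h i) = u (h i) + t i *: (v (h i) - u (h i)).
  by rewrite /f; case: pickP => [j /eqP/h_inj->|/(_ i)]; rewrite ?in_setT ?eqxx.
exists f => [x /h_surj[i _ <-]|].
  by rewrite segmentE fE; exists (t i) => //; exact: t01.
by rewrite sumE /zono_point -big_split; apply: eq_bigr => i _; rewrite fE.
Qed.

Lemma zonotope_zono (Z : set 'rV[R]_d) : zonotope Z ->
  exists n a (g : 'I_n -> 'rV[R]_d), pairwise_free g /\ Z = zono a g.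
Proof.
move=> [n [u [v [uv free_uv ->]]]].
exists n, (\sum_i u i), (fun i => v i - u i); split.
  by split=> [i|]; [rewrite subr_eq0 eq_sym|exact: free_uv].
by apply: minkowski_sum_segments; split=> // i _; exists i.
Qed.

End MinkowskiSums.

Section LatticePoints.
Context {R : realType} {d : nat}.
Implicit Types z : 'rV[int]_d.

HB.instance Definition _ :=
  GRing.Additive.copy (@lattice_point R d) (map_mx intr).

Lemma lattice_pointZ (m : int) z :
  lattice_point (m *: z) = m%:~R *: lattice_point z :> 'rV[R]_d.
Proof. exact: map_mxZ. Qed.

Lemma lattice_point_eq0 z : (lattice_point z == 0 :> 'rV[R]_d) = (z == 0).
Proof.
apply/eqP/eqP => [/rowP z0|->]; last by rewrite raddf0.
by apply/rowP => i; have /eqP := z0 i; rewrite !mxE intr_eq0 => /eqP.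
Qed.

Lemma canonical_primitive_free (x y : 'rV[int]_d) :
    canonical_primitive x -> canonical_primitive y -> x != y ->
  free [:: lattice_point x; lattice_point y : 'rV[R]_d].
Proof.
move=> px py.
rewrite free_cons seq1_free lattice_point_eq0 py.1.1 andbT span_seq1.
apply: contraNN => /vlineP[r /rowP xy]; apply/eqP.
apply: parallel_canonical_primitive => // i j; apply: (@intr_inj R).
by have := xy i; have := xy j; rewrite !intrM !mxE => -> ->; ring.
Qed.

End LatticePoints.

Section LatticeZonotopes.
Context {R : realType} {d : nat} {I : finType}.
Implicit Types (z : I -> 'rV[int]_d) (b : 'rV[int]_d) (l : 'I_d).

Definition lattice_zono b z : set 'rV[R]_d :=
  zono (lattice_point b) (lattice_point \o z).

Lemma lattice_zono_corner b z (A : {set I}) :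
  corner (lattice_point b) (lattice_point \o z) A =
  lattice_point (b + \sum_(i in A) z i) :> 'rV[R]_d.
Proof. by rewrite cornerE raddfD raddf_sum. Qed.

Lemma lattice_polytope_zono (a : 'rV[R]_d) (g : I -> 'rV[R]_d) :
    pairwise_free g -> lattice_polytope (zono a g) ->
  exists b z, zono a g = lattice_zono b z /\ g = lattice_point \o z.
Proof.
move=> g_free [_ vertexZ].
have /choice[z gE] i : exists y, g i = lattice_point y.
  have [c wall_c] := exists_wall g_free i.
  have [chamber_P chamber_iP] := wall_chambers (g_free.1 i) wall_c.
  have [x xE] := vertexZ _ (vertex_corner a chamber_P).
  have [y yE] := vertexZ _ (vertex_corner a chamber_iP).
  exists (y - x); rewrite raddfB /= -xE -yE corner_setU1 ?wall_notin //.
  by rewrite addrAC subrr add0r.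
have {}gE : g = lattice_point \o z by apply/funext.
have [A chamber_A] := exists_chamber g_free.
have [x xE] := vertexZ _ (vertex_corner a chamber_A).
exists (x - \sum_(i in A) z i), z; split=> //.
rewrite /lattice_zono -gE; congr zono.
by rewrite raddfB raddf_sum /= -xE cornerE gE addrK.
Qed.

Definition width z l : int := \sum_i `|z i ord0 l|.

Lemma sum_width z : \sum_l width z l = \sum_i norm1 (z i).
Proof. exact: exchange_big. Qed.

Lemma dot_delta (x : 'rV[R]_d) l : dot (delta_mx ord0 l) x = x ord0 l.
Proof.
rewrite /dot (bigD1 l) //= mxE !eqxx mul1r big1 ?addr0 // => i il.
by rewrite mxE (negbTE il) andbF mul0r.
Qed.

Definition max_coord b z l : R :=
  top_corner (lattice_point b) (lattice_point \o z) (delta_mx ord0 l) ord0 l.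

Definition min_coord b z l : R :=
  top_corner (lattice_point b) (lattice_point \o z) (- delta_mx ord0 l) ord0 l.

Lemma widthE b z l : (width z l)%:~R = max_coord b z l - min_coord b z l.
Proof.
rewrite /max_coord /min_coord -!dot_delta dot_width.
rewrite (big_morph _ (@intrD R) (erefl _)).
by apply: eq_bigr => i _; rewrite dot_delta mxE intr_norm.
Qed.

Lemma lattice_zono_coord_bounds b z x l :
  lattice_zono b z x -> min_coord b z l <= x ord0 l <= max_coord b z l.
Proof.
move=> Zx; rewrite /max_coord /min_coord -!dot_delta.
by rewrite dot_le_top_corner // dot_ge_top_corner.
Qed.

Lemma min_coord_int b z l : exists m : int, min_coord b z l = m%:~R.
Proof.
pose A := positive_set (lattice_point \o z : I -> 'rV[R]_d) (- delta_mx ord0 l).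
exists ((b + \sum_(i in A) z i) ord0 l).
by rewrite /min_coord /top_corner lattice_zono_corner mxE.
Qed.

Lemma fits_in_box_lattice_zono b z k :
  fits_in_box (lattice_zono b z) k <-> forall l, width z l <= k.
Proof.
split=> [[w fit_k] l|width_le].
  pose a : 'rV[R]_d := lattice_point b.
  pose g : I -> 'rV[R]_d := lattice_point \o z.
  have in_box c : 0 <= (w ord0 l)%:~R + top_corner a g c ord0 l <= k%:~R.
    have := fit_k (lattice_point w + top_corner a g c) _ l; rewrite !mxE; apply.
    by exists (top_corner a g c) => //; exact: zono_corner.
  rewrite -(ler_int R) (widthE b).
  have := in_box (delta_mx ord0 l); have := in_box (- delta_mx ord0 l).
  rewrite -/(max_coord b z l) -/(min_coord b z l).
  by move=> /andP[+ _] /andP[_]; lra.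
have /choice[m min_m] := min_coord_int b z.
exists (\row_l - m l) => _ [x Zx <-] l; rewrite !mxE intrN -min_m.
have := lattice_zono_coord_bounds l Zx.
by have := width_le l; rewrite -(ler_int R) (widthE b) => + /andP[]; lra.
Qed.

Lemma box_size_lattice_zono b z : (0 < d)%N ->
  box_size (lattice_zono b z) = \big[Num.max/0]_l width z l.
Proof.
move=> d_gt0; apply: box_size_eq; split.
  by apply/fits_in_box_lattice_zono => l; exact: le_bigmax.
move=> k /fits_in_box_lattice_zono width_le; apply: bigmax_le => [|l _] //.
by apply: le_trans (width_le (Ordinal d_gt0)); exact: sumr_ge0.
Qed.

Lemma sum_norm1_le_box_size b z : (0 < d)%N ->
  \sum_i norm1 (z i) <= d%:Z * box_size (lattice_zono b z).
Proof.
move=> d_gt0; rewrite box_size_lattice_zono // -sum_width.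
apply: le_trans (ler_sum _ (fun l _ => le_bigmax 0 _ l)) _.
by rewrite sumr_const card_ord -mulr_natl natz.
Qed.

Lemma box_size_constant_width b z : (0 < d)%N ->
    (forall l l', width z l = width z l') ->
  d%:Z * box_size (lattice_zono b z) = \sum_i norm1 (z i).
Proof.
move=> d_gt0 width_eq; set w := width z (Ordinal d_gt0).
have wE l : width z l = w by exact: width_eq.
suff -> : box_size (lattice_zono b z) = w.
  rewrite -sum_width (eq_bigr _ (fun l _ => wE l)).
  by rewrite sumr_const card_ord -mulr_natl natz.
rewrite box_size_lattice_zono //; apply/le_anti/andP; split.
  by apply: bigmax_le => [|l _]; [exact: sumr_ge0|rewrite wE].
exact: le_bigmax.
Qed.

End LatticeZonotopes.

Section PrimitiveDirections.
Context {R : realType} {d : nat} {I : finType}.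
Variable z : I -> 'rV[int]_d.
Hypothesis z_free : pairwise_free (lattice_point \o z : I -> 'rV[R]_d).

Lemma primitive_directions : exists x : I -> 'rV[int]_d,
  [/\ injective x, forall i, canonical_primitive (x i) &
      forall i, exists2 m : int, m != 0 & z i = m *: x i].
Proof.
have /choice[x xP] i : exists y,
    canonical_primitive y /\ exists2 m : int, m != 0 & z i = m *: y.
  have [|y [m [prim_y m_neq0 zE]]] := @canonical_primitive_multiple _ (z i).
    by rewrite -(lattice_point_eq0 (R := R)); exact: z_free.1.
  by exists y; split=> //; exists m.
exists x; split=> [i j xij|i|i]; [|by case: (xP i)..].
apply/eqP; apply: contraT => /z_free.2; apply: contraTT => _.
have [[_ [m _ zi]] [_ [m' _ zj]]] := (xP i, xP j).
apply: (@vline_not_free _ _ _ _ (lattice_point (x j))); apply/vlineP.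
  by exists m%:~R; rewrite /= zi lattice_pointZ xij.
by exists m'%:~R; rewrite /= zj lattice_pointZ.
Qed.

Lemma total_norm1_H1_gens_le (p : nat) :
  total_norm1 (H1_gens d p) + p%:Z * (#|I|%:Z - #|` H1_gens d p|%:Z) <=
  \sum_i norm1 (z i).
Proof.
have [x [x_inj x_prim zE]] := primitive_directions.
apply: le_trans (total_norm1_H1_gens_le_primitive x_inj x_prim) _.
by apply: ler_sum => i _; have [m m_neq0 ->] := zE i; exact: le_norm1Z.
Qed.

Lemma H1_generators_upto_sign (p : nat) : #|I| = #|` H1_gens d p| ->
    \sum_i norm1 (z i) <= total_norm1 (H1_gens d p) ->
  exists2 x : I -> 'rV[int]_d, set_bij [set: I] (H1_generators p) x &
    forall i, z i = x i \/ z i = - x i.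
Proof.
have [x [x_inj x_prim zE]] := primitive_directions => cardI sum_le.
have norm1_le i : true ->
    norm1 (x i) <= norm1 (z i) ?= iff (norm1 (x i) == norm1 (z i)).
  by move=> _; apply: leif_eq; have [m m_neq0 ->] := zE i; exact: le_norm1Z.
have [sum_xz sum_eq] := leif_sum norm1_le.
exists x => [|i].
  apply: primitive_set_bij_H1_generators => //.
  exact: le_trans sum_xz sum_le.
have := total_norm1_H1_gens_le_primitive (p := p) x_inj x_prim.
rewrite cardI subrr mulr0 addr0 => /(le_trans sum_le) sum_zx.
move: sum_eq; rewrite eq_le sum_xz sum_zx => /esym/forallP/(_ i)/eqP.
by have [m _ ->] := zE i => /esym; exact: norm1Z_eq.
Qed.

End PrimitiveDirections.

Section H1Zonotope.
Context {R : realType} {d p : nat}.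

Lemma H1_lattice_zono (I : finType) (h : I -> 'rV[int]_d) :
  set_bij [set: I] (H1_generators p) h -> H1 R d p = lattice_zono 0 h.
Proof.
move=> h_bij; rewrite /H1 (minkowski_sum_segments _ _ h_bij).
rewrite /lattice_zono (raddf0 lattice_point) big1 //; congr zono.
by apply/funext => i; rewrite subr0.
Qed.

Lemma H1E : H1 R d p = lattice_zono 0 (val : H1_gens d p -> _).
Proof. exact/H1_lattice_zono/H1_gens_set_bij. Qed.

Lemma diameter_H1 : diameter (H1 R d p) = #|` H1_gens d p|.
Proof.
have H1_prim (z : H1_gens d p) : canonical_primitive (val z).
  by have /H1_gensP[? _ ?] := valP z.
rewrite H1E diameter_zono -?cardfE //; split=> [z|x y xy].
  by rewrite lattice_point_eq0; have [[]] := H1_prim z.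
exact: canonical_primitive_free.
Qed.

Lemma box_size_H1 : (0 < d)%N ->
  d%:Z * box_size (H1 R d p) = total_norm1 (H1_gens d p).
Proof.
move=> d_gt0; rewrite H1E box_size_constant_width // => [|l l'].
  by rewrite /total_norm1 big_seq_fsetE.
by have := fsum_H1_generators_coord p l l'; rewrite !big_seq_fsetE.
Qed.

End H1Zonotope.

Section LatticeZonotopeStructure.
Context {R : realType} {d : nat}.

Lemma lattice_zonotope_zono (Z : set 'rV[R]_d) : lattice_zonotope Z ->
  exists n b (z : 'I_n -> 'rV[int]_d),
    pairwise_free (lattice_point \o z : 'I_n -> 'rV[R]_d) /\
    Z = lattice_zono b z.
Proof.
move=> [/zonotope_zono[n [a [g [g_free ->]]]]].
move=> /(lattice_polytope_zono g_free)[b [z [-> gE]]].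
by exists n, b, z; rewrite -gE.
Qed.

Lemma lattice_zono_flip (I : finType) b (z x : I -> 'rV[int]_d) :
    (forall i, z i = x i \/ z i = - x i) ->
  exists b', lattice_zono b z = lattice_zono b' x :> set 'rV[R]_d.
Proof.
move=> zx; pose S := [set i | z i != x i]%SET.
exists (b - \sum_(i in S) x i).
rewrite /lattice_zono raddfB raddf_sum -zono_flip; congr zono.
apply/funext => i; rewrite inE /=; case: eqVneq => [->//|/eqP].
by case: (zx i) => // -> _; rewrite raddfN.
Qed.

Lemma lattice_zono_translate (I : finType) b (x : I -> 'rV[int]_d) :
  lattice_zono b x = translate (lattice_point b) (lattice_zono 0 x)
    :> set 'rV[R]_d.
Proof. by rewrite -zono_translate raddf0 addr0. Qed.

End LatticeZonotopeStructure.

Lemma translate0 (R : realType) (d : nat) (A : set 'rV[R]_d) :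
  translate 0 A = A.
Proof.
by rewrite /translate; under eq_imagel do rewrite add0r; rewrite image_id.
Qed.

Lemma zono_dim0 (R : realType) (I : finType) (a : 'rV[R]_0)
    (g : I -> 'rV[R]_0) : zono a g = setT.
Proof.
apply/seteqP; split=> // y _.
rewrite (thinmx0 y) -(thinmx0 (corner a g finset.set0)).
exact: zono_corner.
Qed.

Theorem theorem3p1 (R : realType) (d p : nat) (Z : set 'rV[R]_d)
  (hp : (0 < p)%N) (hZ : lattice_zonotope Z) (hdim : has_dim Z d) :
  [/\ (diameter (H1 R d p) <= diameter Z)%N ->
        box_size (H1 R d p) <= box_size Z,
      (diameter (H1 R d p) < diameter Z)%N ->
        box_size (H1 R d p) < box_size Z &
      diameter (H1 R d p) = diameter Z ->
      box_size (H1 R d p) = box_size Z ->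
        exists t : 'rV[R]_d, Z = translate t (H1 R d p)].
Proof.
have [n [b [z [z_free ZE]]]] := lattice_zonotope_zono hZ.
have diamZ : diameter Z = n by rewrite ZE diameter_zono // card_ord.
have [d0|d_gt0] := posnP d.
  have -> : Z = H1 R d p by subst d; rewrite ZE H1E /lattice_zono !zono_dim0.
  by split=> [_|/[!ltnn]//|_ _]; [exact: lexx|exists 0; rewrite translate0].
have sum_ge := total_norm1_H1_gens_le z_free p; rewrite card_ord in sum_ge.
have sum_le := sum_norm1_le_box_size (R := R) b z d_gt0; rewrite -ZE in sum_le.
have sumH := box_size_H1 (R := R) (p := p) d_gt0.
rewrite diamZ diameter_H1 -(@ler_pM2l _ d%:Z) // -(@ltr_pM2l _ d%:Z) // sumH.
split=> [le_n|lt_n|eq_n eq_box].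
- apply: le_trans sum_le; apply: le_trans sum_ge.
  by rewrite lerDl mulr_ge0 // subr_ge0.
- apply: lt_le_trans sum_le; apply: lt_le_trans sum_ge.
  by rewrite ltrDl mulr_gt0 // subr_gt0.
have [||x x_bij zx] := H1_generators_upto_sign z_free (p := p).
- by rewrite card_ord.
- by rewrite -sumH eq_box.
have [b' ZE'] := lattice_zono_flip b zx (R := R).
exists (lattice_point b').
by rewrite ZE ZE' lattice_zono_translate (H1_lattice_zono x_bij).
Qed.
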